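(* For a Cauchy complete $*$-autonomous category $\mathcal C$ (not assumed symmetric), a right $\otimes$-trace and a left $⅋$-trace are equivalent, where $⅋$ denotes the par tensor product of $\mathcal C$. That is, transport along the duality gives a bijection between right $\otimes$-traces $\mathsf{RTr}$ on $\mathcal C$ and left $⅋$-traces $\mathsf{LTr}$ on $\mathcal C$: the left $⅋$-trace corresponding to $\mathsf{RTr}$ sends $f\colon X⅋ A\to X⅋ B$ to the unique morphism $\mathsf{LTr}^X_{A,B}(f)\colon A\to B$ such that $${}^*\bigl(\mathsf{LTr}^X_{A,B}(f)\bigr)=\mathsf{RTr}^{{}^*X}_{{}^*B,{}^*A}\bigl({}^*B\otimes{}^*X\cong{}^*(X⅋ B)\xrightarrow{{}^*f}{}^*(X⅋ A)\cong{}^*A\otimes{}^*X\bigr)\colon{}^*B\to{}^*A .$$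
   Context: Here $⅋$ is simply a symbol for the ''par'' tensor of a $*$-autonomous category (the upside-down ampersand of linear logic; read it as an ordinary binary operation symbol). **$*$-autonomous categories** (non-symmetric, in the sense of Barr). A $*$-autonomous category is a monoidal category $(\mathcal C,\otimes,I)$ with an object $\bot$ such that there are contravariant equivalences $(-)^*,{}^*(-)\colon\mathcal C^{\mathrm{op}}\to\mathcal C$, inverse to each other (${}^*(A^* )\cong A\cong({}^*A)^*$), with natural bijections $\mathcal C(A\otimes B,\bot)\cong\mathcal C(B,A^* )\cong\mathcal C(A,{}^*B)$, and $\mathcal C$ is biclosed in the corresponding way. The par tensor is $A⅋ B={}^*(B^*\otimes A^* )\cong({}^*B\otimes{}^*A)^*$; it is a monoidal structure with unit $\bot$. Both dualities exchange the two tensors, reversing order: $(A⅋ B)^*\cong B^*\otimes A^*$ and ${}^*(A⅋ B)\cong{}^*B\otimes{}^*A$, coherently, with ${}^*\bot\cong I\cong\bot^*$. A category is Cauchy complete if all its idempotents split. **Right $\otimes$-trace.** With $\alpha_{A,B,D}\colon(A\otimes B)\otimes D\to A\otimes(B\otimes D)$ and $\rho$ the right unitor of $\otimes$, a right $\otimes$-trace is a family of maps $\mathsf{RTr}^X_{A,B}\colon\mathcal C(A\otimes X,B\otimes X)\to\mathcal C(A,B)$ such that - $\mathsf{RTr}^X((g\otimes\mathrm{id}_X)\circ h\circ(f\otimes\mathrm{id}_X))=g\circ\mathsf{RTr}^X(h)\circ f$ for $f\colon A\to A'$, $h\colon A'\otimes X\to B\otimes X$, $g\colon B\to B'$; - $\mathsf{RTr}^{X'}((\mathrm{id}_B\otimes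 p)\circ h)=\mathsf{RTr}^X(h\circ(\mathrm{id}_A\otimes p))$ for $p\colon X\to X'$, $h\colon A\otimes X'\to B\otimes X$; - $\mathsf{RTr}^I(f)=\rho_B\circ f\circ\rho_A^{-1}$ for $f\colon A\otimes I\to B\otimes I$; - $\mathsf{RTr}^X(\mathsf{RTr}^Y(f))=\mathsf{RTr}^{X\otimes Y}(\alpha_{B,X,Y}\circ f\circ\alpha^{-1}_{A,X,Y})$ for $f\colon(A\otimes X)\otimes Y\to(B\otimes X)\otimes Y$; - $g\otimes\mathsf{RTr}^X(f)=\mathsf{RTr}^X(\alpha^{-1}_{E,B,X}\circ(g\otimes f)\circ\alpha_{D,A,X})$ for $g\colon D\to E$, $f\colon A\otimes X\to B\otimes X$. **Left $⅋$-trace.** The mirror image for $⅋$: with $\alpha_{A,B,D}\colon(A⅋ B)⅋ D\to A⅋(B⅋ D)$ and $\lambda_A\colon\bot⅋ A\to A$ the structural isomorphisms of $⅋$, a family of maps $\mathsf{LTr}^X_{A,B}\colon\mathcal C(X⅋ A,X⅋ B)\to\mathcal C(A,B)$ such that - $\mathsf{LTr}^X((\mathrm{id}_X⅋ g)\circ h\circ(\mathrm{id}_X⅋ f))=g\circ\mathsf{LTr}^X(h)\circ f$ for $f\colon A\to A'$, $h\colon X⅋ A'\to X⅋ B$, $g\colon B\to B'$; - $\mathsf{LTr}^{X'}((p⅋\mathrm{id}_B)\circ h)=\mathsf{LTr}^X(h\circ(p⅋\mathrm{id}_A))$ for $p\colon X\to X'$, $h\colon X'⅋ A\to X⅋ B$;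 - $\mathsf{LTr}^\bot(f)=\lambda_B\circ f\circ\lambda_A^{-1}$ for $f\colon\bot⅋ A\to\bot⅋ B$; - $\mathsf{LTr}^X(\mathsf{LTr}^Y(f))=\mathsf{LTr}^{Y⅋ X}(\alpha^{-1}_{Y,X,B}\circ f\circ\alpha_{Y,X,A})$ for $f\colon Y⅋(X⅋ A)\to Y⅋(X⅋ B)$; - $\mathsf{LTr}^X(f)⅋ g=\mathsf{LTr}^X(\alpha_{X,B,E}\circ(f⅋ g)\circ\alpha^{-1}_{X,A,D})$ for $g\colon D\to E$, $f\colon X⅋ A\to X⅋ B$. *)

(* Defs.v *)
From Corelib Require Import ssreflect ssrfun.

Set Implicit Arguments.
Unset Strict Implicit.
Unset Printing Implicit Defensive.

Declare Scope cat_scope.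
Delimit Scope cat_scope with cat.
Local Open Scope cat_scope.

Record category := Category {
  ob :> Type;
  hom : ob -> ob -> Type;
  idm : forall A, hom A A;
  comp : forall A B D, hom B D -> hom A B -> hom A D;
  comp1m : forall A B (f : hom A B), comp (idm B) f = f;
  compm1 : forall A B (f : hom A B), comp f (idm A) = f;
  compA : forall A B D E (h : hom D E) (g : hom B D) (f : hom A B),
    comp h (comp g f) = comp (comp h g) f
}.
Arguments hom {c} A B.
Arguments idm {c} A.
Arguments comp {c A B D} g f.

Notation "g ∘ f" := (comp g f) (at level 40, left associativity) : cat_scope.

Definition cauchy_complete (C : category) : Prop :=
  forall (A : C) (e : hom A A), e ∘ e = e ->
  exists (B : C) (r : hom A B) (s : hom B A), s ∘ r = e /\ r ∘ s = idm B.

Record iso (C : category) (A B : C) := Iso {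
  fwd : hom A B;
  bwd : hom B A;
  fwdK : bwd ∘ fwd = idm A;
  bwdK : fwd ∘ bwd = idm B
}.

Definition iso_inv (C : category) (A B : C) (i : iso A B) : iso B A :=
  Iso (bwdK i) (fwdK i).

Definition iso_comp (C : category) (A B D : C) (j : iso B D) (i : iso A B) :
  iso A D.
Proof.
refine (@Iso C A D (fwd j ∘ fwd i) (bwd i ∘ bwd j) _ _).
- by rewrite compA -(compA (bwd i)) fwdK compm1 fwdK.
- by rewrite compA -(compA (fwd j)) bwdK compm1 bwdK.
Defined.

Record contravariant (C : category) := Contravariant {
  cob :> C -> C;
  cmap : forall A B, hom A B -> hom (cob B) (cob A);
  cmap1 : forall A, cmap (idm A) = idm (cob A);
  cmapM : forall A B D (g : hom B D) (f : hom A B),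
    cmap (g ∘ f) = cmap f ∘ cmap g
}.
Arguments cmap {C} c {A B} f.

Definition iso_cmap (C : category) (F : contravariant C) (A B : C)
  (i : iso A B) : iso (F B) (F A).
Proof.
refine (@Iso C (F B) (F A) (cmap F (fwd i)) (cmap F (bwd i)) _ _).
- by rewrite -cmapM bwdK cmap1.
- by rewrite -cmapM fwdK cmap1.
Defined.

Record monoidal (C : category) := Monoidal {
  tob : C -> C -> C;
  tmap : forall A A' B B',
    hom A A' -> hom B B' -> hom (tob A B) (tob A' B');
  unit : C;
  assoc : forall A B D, iso (tob (tob A B) D) (tob A (tob B D));
  lunitor : forall A, iso (tob unit A) A;
  runitor : forall A, iso (tob A unit) A;
  tmap1 : forall A B, tmap (idm A) (idm B) = idm (tob A B);
  tmapM : forall A A' A'' B B' B'' (f' : hom A' A'') (f : hom A A')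
      (g' : hom B' B'') (g : hom B B'),
    tmap (f' ∘ f) (g' ∘ g) = tmap f' g' ∘ tmap f g;
  assoc_nat : forall A A' B B' D D'
      (f : hom A A') (g : hom B B') (h : hom D D'),
    fwd (assoc A' B' D') ∘ tmap (tmap f g) h =
    tmap f (tmap g h) ∘ fwd (assoc A B D);
  lunitor_nat : forall A A' (f : hom A A'),
    fwd (lunitor A') ∘ tmap (idm unit) f = f ∘ fwd (lunitor A);
  runitor_nat : forall A A' (f : hom A A'),
    fwd (runitor A') ∘ tmap f (idm unit) = f ∘ fwd (runitor A);
  pentagon : forall A B D E,
    tmap (idm A) (fwd (assoc B D E)) ∘ fwd (assoc A (tob B D) E)
      ∘ tmap (fwd (assoc A B D)) (idm E) =
    fwd (assoc A B (tob D E)) ∘ fwd (assoc (tob A B) D E);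
  triangle : forall A B,
    tmap (idm A) (fwd (lunitor B)) ∘ fwd (assoc A unit B) =
    tmap (fwd (runitor A)) (idm B)
}.
Arguments unit {C} m.

Notation "A ⊗[ M ] B" := (tob M A B)
  (at level 35, right associativity, format "A  ⊗[ M ]  B") : cat_scope.
Notation "f ⊗₁[ M ] g" := (tmap M f g)
  (at level 35, right associativity, format "f  ⊗₁[ M ]  g") : cat_scope.

Definition iso_tmap (C : category) (M : monoidal C) (A A' B B' : C)
  (i : iso A A') (j : iso B B') : iso (A ⊗[M] B) (A' ⊗[M] B').
Proof.
refine (@Iso C _ _ (fwd i ⊗₁[M] fwd j) (bwd i ⊗₁[M] bwd j) _ _).
- by rewrite -tmapM !fwdK tmap1.
- by rewrite -tmapM !bwdK tmap1.
Defined.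

Definition iso_id (C : category) (A : C) : iso A A :=
  Iso (comp1m (idm A)) (comp1m (idm A)).

Record right_trace (C : category) (M : monoidal C) := RightTrace {
  rtr :> forall X A B : C, hom (A ⊗[M] X) (B ⊗[M] X) -> hom A B;
  rtr_tight : forall (X A A' B B' : C)
      (f : hom A A') (h : hom (A' ⊗[M] X) (B ⊗[M] X)) (g : hom B B'),
    rtr ((g ⊗₁[M] idm X) ∘ h ∘ (f ⊗₁[M] idm X)) = g ∘ rtr h ∘ f;
  rtr_slide : forall (X X' A B : C)
      (p : hom X X') (h : hom (A ⊗[M] X') (B ⊗[M] X)),
    rtr ((idm B ⊗₁[M] p) ∘ h) = rtr (h ∘ (idm A ⊗₁[M] p));
  rtr_unit : forall (A B : C) (f : hom (A ⊗[M] unit M) (B ⊗[M] unit M)),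
    rtr f = fwd (runitor M B) ∘ f ∘ bwd (runitor M A);
  rtr_tensor : forall (X Y A B : C)
      (f : hom ((A ⊗[M] X) ⊗[M] Y) ((B ⊗[M] X) ⊗[M] Y)),
    rtr (rtr f) = rtr (fwd (assoc M B X Y) ∘ f ∘ bwd (assoc M A X Y));
  rtr_superpose : forall (X A B D E : C)
      (g : hom D E) (f : hom (A ⊗[M] X) (B ⊗[M] X)),
    g ⊗₁[M] rtr f =
    rtr (bwd (assoc M E B X) ∘ (g ⊗₁[M] f) ∘ fwd (assoc M D A X))
}.

Record left_trace (C : category) (M : monoidal C) := LeftTrace {
  ltr :> forall X A B : C, hom (X ⊗[M] A) (X ⊗[M] B) -> hom A B;
  ltr_tight : forall (X A A' B B' : C)
      (f : hom A A') (h : hom (X ⊗[M] A') (X ⊗[M] B)) (g : hom B B'),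
    ltr ((idm X ⊗₁[M] g) ∘ h ∘ (idm X ⊗₁[M] f)) = g ∘ ltr h ∘ f;
  ltr_slide : forall (X X' A B : C)
      (p : hom X X') (h : hom (X' ⊗[M] A) (X ⊗[M] B)),
    ltr ((p ⊗₁[M] idm B) ∘ h) = ltr (h ∘ (p ⊗₁[M] idm A));
  ltr_unit : forall (A B : C) (f : hom (unit M ⊗[M] A) (unit M ⊗[M] B)),
    ltr f = fwd (lunitor M B) ∘ f ∘ bwd (lunitor M A);
  ltr_tensor : forall (X Y A B : C)
      (f : hom (Y ⊗[M] (X ⊗[M] A)) (Y ⊗[M] (X ⊗[M] B))),
    ltr (ltr f) = ltr (bwd (assoc M Y X B) ∘ f ∘ fwd (assoc M Y X A));
  ltr_superpose : forall (X A B D E : C)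
      (g : hom D E) (f : hom (X ⊗[M] A) (X ⊗[M] B)),
    ltr f ⊗₁[M] g =
    ltr (fwd (assoc M X B E) ∘ (f ⊗₁[M] g) ∘ bwd (assoc M X A D))
}.

(* [rdual] is A |-> A^* and [ldual] is A |-> ^*A.  The isomorphisms
   A ≅ ^*(A^* ) and A ≅ (^*A)^* are the units of the adjunction
   C(B, A^* ) ≅ C(A ⊗ B, ⊥) ≅ C(A, ^*B); their invertibility says that the two
   dualities are mutually inverse equivalences.  Biclosedness follows, the
   internal homs being D ↦ ^*(B ⊗ D^* ) and D ↦ (^*D ⊗ A)^*. *)
Record star_autonomous (C : category) := StarAutonomous {
  tensor :> monoidal C;
  bot : C;
  rdual : contravariant C;
  ldual : contravariant C;
  rcurry : forall A B, hom (A ⊗[tensor] B) bot -> hom B (rdual A);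
  runcurry : forall A B, hom B (rdual A) -> hom (A ⊗[tensor] B) bot;
  rcurryK : forall A B, cancel (@rcurry A B) (@runcurry A B);
  runcurryK : forall A B, cancel (@runcurry A B) (@rcurry A B);
  rcurry_nat : forall A A' B B'
      (f : hom A A') (g : hom B B') (h : hom (A' ⊗[tensor] B') bot),
    rcurry (h ∘ (f ⊗₁[tensor] g)) = cmap rdual f ∘ rcurry h ∘ g;
  lcurry : forall A B, hom (A ⊗[tensor] B) bot -> hom A (ldual B);
  luncurry : forall A B, hom A (ldual B) -> hom (A ⊗[tensor] B) bot;
  lcurryK : forall A B, cancel (@lcurry A B) (@luncurry A B);
  luncurryK : forall A B, cancel (@luncurry A B) (@lcurry A B);
  lcurry_nat : forall A A' B B'
      (f : hom A A') (g : hom B B') (h : hom (A' ⊗[tensor] B') bot),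
    lcurry (h ∘ (f ⊗₁[tensor] g)) = cmap ldual g ∘ lcurry h ∘ f;
  lrdual : forall A, iso A (ldual (rdual A));
  lrdualE : forall A, fwd (lrdual A) = lcurry (runcurry (idm (rdual A)));
  rldual : forall A, iso A (rdual (ldual A));
  rldualE : forall A, fwd (rldual A) = rcurry (luncurry (idm (ldual A)))
}.
Arguments bot {C} s.

Section Par.

Context (C : category) (S : star_autonomous C).

Local Notation "A ⊗ B" := (tob S A B) (at level 35, right associativity).
Local Notation "f ⊗₁ g" := (tmap S f g) (at level 35, right associativity).
Local Notation "A ^*" := (rdual S A) (at level 2, format "A ^*").
Local Notation "^* A" := (ldual S A) (at level 2, format "^* A").

Lemma lcurry_comp (A A' B : C) (h : hom (A' ⊗ B) (bot S)) (f : hom A A') :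
  lcurry (h ∘ (f ⊗₁ idm B)) = lcurry h ∘ f.
Proof. by rewrite lcurry_nat cmap1 comp1m. Qed.

Lemma rcurry_comp (A B B' : C) (h : hom (A ⊗ B') (bot S)) (g : hom B B') :
  rcurry (h ∘ (idm A ⊗₁ g)) = rcurry h ∘ g.
Proof. by rewrite rcurry_nat cmap1 comp1m. Qed.

Lemma luncurry_nat (A A' B B' : C) (f : hom A A') (g : hom B B')
    (k : hom A' (^* B')) :
  luncurry (cmap (ldual S) g ∘ k ∘ f) = luncurry k ∘ (f ⊗₁ g).
Proof. by rewrite -{1}(luncurryK k) -lcurry_nat lcurryK. Qed.

Lemma runcurry_nat (A A' B B' : C) (f : hom A A') (g : hom B B')
    (k : hom B' (A'^*)) :
  runcurry (cmap (rdual S) f ∘ k ∘ g) = runcurry k ∘ (f ⊗₁ g).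
Proof. by rewrite -{1}(runcurryK k) -rcurry_nat rcurryK. Qed.

Lemma luncurry_comp (A A' B : C) (f : hom A A') (k : hom A' (^* B)) :
  luncurry (k ∘ f) = luncurry k ∘ (f ⊗₁ idm B).
Proof. by rewrite -luncurry_nat cmap1 comp1m. Qed.

Lemma runcurry_comp (A B B' : C) (g : hom B B') (k : hom B' (A^*)) :
  runcurry (k ∘ g) = runcurry k ∘ (idm A ⊗₁ g).
Proof. by rewrite -runcurry_nat cmap1 comp1m. Qed.

Lemma lrdual_nat (A B : C) (f : hom A B) :
  fwd (lrdual S B) ∘ f = cmap (ldual S) (cmap (rdual S) f) ∘ fwd (lrdual S A).
Proof.
rewrite !lrdualE -lcurry_comp.
rewrite -[RHS]compm1 -lcurry_nat.
by rewrite -!runcurry_nat !cmap1 !comp1m !compm1.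
Qed.

Lemma rldual_nat (A B : C) (f : hom A B) :
  fwd (rldual S B) ∘ f = cmap (rdual S) (cmap (ldual S) f) ∘ fwd (rldual S A).
Proof.
rewrite !rldualE -rcurry_comp.
rewrite -[RHS]compm1 -rcurry_nat.
by rewrite -!luncurry_nat !cmap1 !comp1m !compm1.
Qed.

Lemma lrdual_rldual (A : C) :
  cmap (rdual S) (fwd (lrdual S A)) ∘ fwd (rldual S (A^*)) = idm (A^*).
Proof.
rewrite rldualE -[LHS]compm1 -rcurry_nat -luncurry_comp comp1m lrdualE.
by rewrite lcurryK runcurryK.
Qed.

Lemma cmap_lrdual_bwd (A : C) :
  cmap (rdual S) (bwd (lrdual S A)) = fwd (rldual S (A^* )).
Proof.
rewrite -[LHS]compm1 -lrdual_rldual compA -cmapM bwdK.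
by rewrite cmap1 comp1m.
Qed.

Lemma iso_nat (A A' B B' : C) (i : iso A B) (j : iso A' B')
    (f : hom A A') (g : hom B B') :
  fwd j ∘ f = g ∘ fwd i -> bwd j ∘ g = f ∘ bwd i.
Proof.
move=> e; rewrite -[g in LHS]compm1 -(bwdK i) (compA g) -e.
by rewrite !compA fwdK comp1m.
Qed.

Lemma cmap_ldualK (A B : C) (f : hom A B) :
  cmap (rdual S) (cmap (ldual S) f) =
  fwd (rldual S B) ∘ f ∘ bwd (rldual S A).
Proof. by rewrite rldual_nat -compA bwdK compm1. Qed.

Lemma tmap_compl (A B D E : C) (g : hom B D) (f : hom A B) :
  (g ∘ f) ⊗₁ idm E = (g ⊗₁ idm E) ∘ (f ⊗₁ idm E).
Proof. by rewrite -tmapM comp1m. Qed.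

Lemma tmap_compr (A B D E : C) (g : hom B D) (f : hom A B) :
  idm E ⊗₁ (g ∘ f) = (idm E ⊗₁ g) ∘ (idm E ⊗₁ f).
Proof. by rewrite -tmapM comp1m. Qed.

Lemma tmap_swap (A A' B B' : C) (f : hom A A') (g : hom B B') :
  (f ⊗₁ idm B') ∘ (idm A ⊗₁ g) = (idm A' ⊗₁ g) ∘ (f ⊗₁ idm B).
Proof. by rewrite -!tmapM !comp1m !compm1. Qed.

Lemma tmap_cancelr (A B D Z : C) (g : hom B A) (f : hom A B)
    (k : hom Z (D ⊗ A)) :
  g ∘ f = idm A -> (idm D ⊗₁ g) ∘ ((idm D ⊗₁ f) ∘ k) = k.
Proof. by move=> e; rewrite compA -tmap_compr e tmap1 comp1m. Qed.

Lemma tmap_cancell (A B D Z : C) (g : hom B A) (f : hom A B)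
    (k : hom Z (A ⊗ D)) :
  g ∘ f = idm A -> (g ⊗₁ idm D) ∘ ((f ⊗₁ idm D) ∘ k) = k.
Proof. by move=> e; rewrite compA -tmap_compl e tmap1 comp1m. Qed.

Definition ldual_unit : iso (bot S) (^* (unit S)).
Proof.
refine (@Iso C _ _ (lcurry (fwd (runitor S (bot S))))
  (luncurry (idm (^* (unit S))) ∘ bwd (runitor S _)) _ _).
- rewrite -compA (iso_nat (runitor_nat _ _)) compA -luncurry_comp comp1m.
  by rewrite lcurryK bwdK.
- by rewrite -lcurry_comp runitor_nat -compA fwdK compm1 luncurryK.
Defined.

(* By naturality this is the transpose of the right unitor at ⊥. *)
Definition rdual_bot : iso (unit S) ((bot S)^* ) :=
  iso_comp (iso_cmap (rdual S) ldual_unit) (rldual S (unit S)).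

Definition par_ob (A B : C) : C := ^* (B^* ⊗ A^* ).

Definition par_map (A A' B B' : C) (f : hom A A') (g : hom B B') :
    hom (par_ob A B) (par_ob A' B') :=
  cmap (ldual S) (cmap (rdual S) g ⊗₁ cmap (rdual S) f).

Definition rdual_par (A B : C) : iso ((par_ob A B)^* ) (B^* ⊗ A^* ) :=
  iso_inv (rldual S (B^* ⊗ A^* )).

Definition dual_assoc (A B D : C) :
    iso ((par_ob B D)^* ⊗ A^* ) (D^* ⊗ (par_ob A B)^* ) :=
  iso_comp (iso_tmap S (iso_id (D^* )) (iso_inv (rdual_par A B)))
    (iso_comp (assoc S (D^* ) (B^* ) (A^* ))
      (iso_tmap S (rdual_par B D) (iso_id (A^* )))).

Definition par_assoc (A B D : C) :
    iso (par_ob (par_ob A B) D) (par_ob A (par_ob B D)) :=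
  iso_cmap (ldual S) (dual_assoc A B D).

Definition dual_lunitor (A : C) : iso (A^* ) (A^* ⊗ (bot S)^* ) :=
  iso_comp (iso_tmap S (iso_id (A^* )) rdual_bot)
    (iso_inv (runitor S (A^* ))).

Definition par_lunitor (A : C) : iso (par_ob (bot S) A) A :=
  iso_comp (iso_inv (lrdual S A)) (iso_cmap (ldual S) (dual_lunitor A)).

Definition dual_runitor (A : C) : iso (A^* ) ((bot S)^* ⊗ A^* ) :=
  iso_comp (iso_tmap S rdual_bot (iso_id (A^* )))
    (iso_inv (lunitor S (A^* ))).

Definition par_runitor (A : C) : iso (par_ob A (bot S)) A :=
  iso_comp (iso_inv (lrdual S A)) (iso_cmap (ldual S) (dual_runitor A)).

Lemma par_map1 (A B : C) : par_map (idm A) (idm B) = idm (par_ob A B).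
Proof. by rewrite /par_map !cmap1 tmap1 cmap1. Qed.

Lemma par_mapM (A A' A'' B B' B'' : C) (f' : hom A' A'') (f : hom A A')
    (g' : hom B' B'') (g : hom B B') :
  par_map (f' ∘ f) (g' ∘ g) = par_map f' g' ∘ par_map f g.
Proof. by rewrite /par_map !cmapM tmapM cmapM. Qed.

Lemma par_assoc_nat (A A' B B' D D' : C)
    (f : hom A A') (g : hom B B') (h : hom D D') :
  fwd (par_assoc A' B' D') ∘ par_map (par_map f g) h =
  par_map f (par_map g h) ∘ fwd (par_assoc A B D).
Proof.
rewrite /par_map /= -!cmapM; congr (cmap _ _).
rewrite !cmap_ldualK.
move: (cmap _ f) (cmap _ g) (cmap _ h) => {}f {}g {}h.
set p' := rldual S (D'^* ⊗ _); set p := rldual S (D^* ⊗ _).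
set q' := rldual S (B'^* ⊗ _); set q := rldual S (B^* ⊗ _).
transitivity ((idm (D^* ) ⊗₁ fwd q) ∘ (h ⊗₁ (g ⊗₁ f)) ∘
  fwd (assoc S _ _ _) ∘ (bwd p' ⊗₁ idm (A'^* ))).
  rewrite !compA -!tmapM comp1m compm1.
  by rewrite -(compA _ (bwd q')) fwdK compm1.
rewrite -!compA (compA (h ⊗₁ _)) -assoc_nat -!compA -!tmapM compm1 comp1m.
by rewrite !compA fwdK comp1m.
Qed.

Lemma par_lunitor_nat (A A' : C) (f : hom A A') :
  fwd (par_lunitor A') ∘ par_map (idm (bot S)) f = f ∘ fwd (par_lunitor A).
Proof.
rewrite /= compA -(iso_nat (lrdual_nat f)) -!compA; congr (_ ∘ _).
rewrite /par_map -!cmapM cmap1; congr (cmap _ _).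
rewrite compA tmap_swap -!compA; congr (_ ∘ _).
by rewrite -(iso_nat (runitor_nat _ _)).
Qed.

Lemma par_runitor_nat (A A' : C) (f : hom A A') :
  fwd (par_runitor A') ∘ par_map f (idm (bot S)) = f ∘ fwd (par_runitor A).
Proof.
rewrite /= compA -(iso_nat (lrdual_nat f)) -!compA; congr (_ ∘ _).
rewrite /par_map -!cmapM cmap1; congr (cmap _ _).
rewrite compA -tmap_swap -!compA; congr (_ ∘ _).
by rewrite -(iso_nat (lunitor_nat _ _)).
Qed.

Lemma par_pentagon (A B D E : C) :
  par_map (idm A) (fwd (par_assoc B D E)) ∘ fwd (par_assoc A (par_ob B D) E)
    ∘ par_map (fwd (par_assoc A B D)) (idm E) =
  fwd (par_assoc A B (par_ob D E)) ∘ fwd (par_assoc (par_ob A B) D E).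
Proof.
rewrite /par_map !cmap1 -!cmapM; congr (cmap _ _).
rewrite !cmap_ldualK /=.
set q1 := rldual S (D^* ⊗ B^* ); set q2 := rldual S (B^* ⊗ A^* ).
set q3 := rldual S (E^* ⊗ D^* ).
set q4 := rldual S ((par_ob _ _)^* ⊗ A^* ).
set q5 := rldual S (D^* ⊗ (par_ob _ _)^* ).
set q6 := rldual S (E^* ⊗ (par_ob _ _)^* ).
set q7 := rldual S ((par_ob _ _)^* ⊗ B^* ).
rewrite !tmap_compl !tmap_compr.
rewrite -!compA; congr (_ ∘ _).
rewrite (tmap_cancelr _ (fwdK q4)) (tmap_cancell _ (fwdK q6)).
rewrite (compA _ ((_ ⊗₁ _) ⊗₁ _)) assoc_nat -!compA.
have e : (bwd q1 ⊗₁ idm (A^* )) ∘ (fwd q1 ⊗₁ idm (A^* )) = idm _.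
  by rewrite -tmap_compl fwdK tmap1.
rewrite (tmap_cancelr _ e).
rewrite (compA (idm (E^* ) ⊗₁ fwd (assoc _ _ _ _))) (compA (_ ∘ _)) pentagon.
rewrite (compA (bwd q3 ⊗₁ _)) tmap_swap -!compA.
rewrite (compA (fwd (assoc S (E^* ) (D^* ) _)) (_ ⊗₁ fwd q2)) -tmap1.
rewrite assoc_nat -!compA; congr (_ ∘ (_ ∘ _)).
have := assoc_nat S (bwd q3) (idm (B^* )) (idm (A^* )); rewrite tmap1 => e'.
by rewrite (compA (bwd q3 ⊗₁ _)) -e' -!compA.
Qed.

Lemma par_triangle (A B : C) :
  par_map (idm A) (fwd (par_lunitor B)) ∘ fwd (par_assoc A (bot S) B) =
  par_map (fwd (par_runitor A)) (idm B).
Proof.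
have dual_unitor X Y (l : hom (X^* ) Y) :
    cmap (rdual S) (bwd (lrdual S X) ∘ cmap (ldual S) l) =
    fwd (rldual S Y) ∘ l.
  by rewrite cmapM cmap_ldualK cmap_lrdual_bwd -compA fwdK compm1.
rewrite /par_map !cmap1 -!cmapM; congr (cmap _ _).
rewrite !dual_unitor /=.
set q := rldual S _; set q' := rldual S _.
move: (_ ∘ _ : hom (unit S) _) => u.
rewrite !tmap_compl !tmap_compr -!compA; congr (_ ∘ _).
rewrite (tmap_cancell _ (fwdK q')) (compA _ ((_ ⊗₁ _) ⊗₁ _)).
rewrite assoc_nat -!compA; congr (_ ∘ _).
have e : (idm (B^* ) ⊗₁ bwd (lunitor S (A^* ))) ∘
    (fwd (runitor S (B^* )) ⊗₁ idm (A^* )) = fwd (assoc S _ _ _).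
  rewrite -triangle.
  by apply: tmap_cancelr; exact: fwdK.
by rewrite -e -compA -tmap_compl bwdK tmap1 compm1.
Qed.

Definition par : monoidal C :=
  Monoidal par_map1 par_mapM par_assoc_nat par_lunitor_nat par_runitor_nat
    par_pentagon par_triangle.

(* The bijection C(W ⊗ A^*, ⊥) ≅ C(W, A) ≅ C(^*A ⊗ W, ⊥). *)
Definition rotate (W A : C) (h : hom (W ⊗ A^* ) (bot S)) :
    hom (^* A ⊗ W) (bot S) :=
  runcurry (fwd (rldual S A) ∘ bwd (lrdual S A) ∘ lcurry h).

Definition unrotate (W A : C) (k : hom (^* A ⊗ W) (bot S)) :
    hom (W ⊗ A^* ) (bot S) :=
  luncurry (fwd (lrdual S A) ∘ bwd (rldual S A) ∘ rcurry k).

Lemma rotateK (W A : C) : cancel (@rotate W A) (@unrotate W A).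
Proof.
move=> h; rewrite /rotate /unrotate runcurryK !compA.
rewrite -(compA _ (bwd (rldual S A))) fwdK compm1 bwdK comp1m.
exact: lcurryK.
Qed.

Lemma unrotateK (W A : C) : cancel (@unrotate W A) (@rotate W A).
Proof.
move=> k; rewrite /rotate /unrotate luncurryK !compA.
rewrite -(compA _ (bwd (lrdual S A))) fwdK compm1 bwdK comp1m.
exact: rcurryK.
Qed.

Lemma rotate_comp (V W A : C) (h : hom (W ⊗ A^* ) (bot S)) (f : hom V W) :
  rotate (h ∘ (f ⊗₁ idm (A^* ))) = rotate h ∘ (idm (^* A) ⊗₁ f).
Proof. by rewrite /rotate lcurry_comp compA runcurry_comp. Qed.

Lemma unrotate_comp (V W A : C) (k : hom (^* A ⊗ W) (bot S)) (f : hom V W) :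
  unrotate (k ∘ (idm (^* A) ⊗₁ f)) = unrotate k ∘ (f ⊗₁ idm (A^* )).
Proof. by rewrite /unrotate rcurry_comp compA luncurry_comp. Qed.

(* Both A ⅋ B = ^*(B^* ⊗ A^* ) and (^*B ⊗ ^*A)^* represent the functor
   Z |-> C((Z ⊗ B^* ) ⊗ A^*, ⊥) ≅ C(^*B ⊗ (^*A ⊗ Z), ⊥). *)
Definition par_to (A B Z : C) (z : hom Z (par_ob A B)) :
    hom Z ((^* B ⊗ ^* A)^* ) :=
  rcurry (rotate (rotate (luncurry z ∘ fwd (assoc S Z (B^* ) (A^* )))
                    ∘ fwd (assoc S (^* A) Z (B^* )))
            ∘ fwd (assoc S (^* B) (^* A) Z)).

Definition par_from (A B Z : C) (z : hom Z ((^* B ⊗ ^* A)^* )) :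
    hom Z (par_ob A B) :=
  lcurry (unrotate (unrotate (runcurry z ∘ bwd (assoc S (^* B) (^* A) Z))
                      ∘ bwd (assoc S (^* A) Z (B^* )))
            ∘ bwd (assoc S Z (B^* ) (A^* ))).

Lemma par_toK (A B Z : C) : cancel (@par_to A B Z) (@par_from A B Z).
Proof.
move=> z; rewrite /par_from /par_to rcurryK.
rewrite -(compA _ (fwd _)) bwdK compm1 rotateK.
rewrite -(compA _ (fwd _)) bwdK compm1 rotateK.
by rewrite -(compA _ (fwd _)) bwdK compm1 luncurryK.
Qed.

Lemma par_fromK (A B Z : C) : cancel (@par_from A B Z) (@par_to A B Z).
Proof.
move=> z; rewrite /par_from /par_to lcurryK.
rewrite -(compA _ (bwd _)) fwdK compm1 unrotateK.
rewrite -(compA _ (bwd _)) fwdK compm1 unrotateK.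
by rewrite -(compA _ (bwd _)) fwdK compm1 runcurryK.
Qed.

Lemma par_to_comp (A B Y Z : C) (z : hom Z (par_ob A B)) (f : hom Y Z) :
  par_to (z ∘ f) = par_to z ∘ f.
Proof.
rewrite /par_to luncurry_comp -tmap1 -(compA _ (f ⊗₁ _)) -assoc_nat compA.
rewrite rotate_comp -(compA _ (_ ⊗₁ _)) -assoc_nat compA.
rewrite rotate_comp -(compA _ (_ ⊗₁ _)) -assoc_nat tmap1 compA.
by rewrite rcurry_comp.
Qed.

Lemma par_from_comp (A B Y Z : C) (z : hom Z ((^* B ⊗ ^* A)^* ))
    (f : hom Y Z) :
  par_from (z ∘ f) = par_from z ∘ f.
Proof.
by rewrite -{1}(par_fromK z) -par_to_comp par_toK.
Qed.

Definition par_iso (A B : C) : iso (par_ob A B) ((^* B ⊗ ^* A)^* ).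
Proof.
refine (@Iso C _ _ (par_to (idm _)) (par_from (idm _)) _ _).
- by rewrite -par_from_comp comp1m par_toK.
- by rewrite -par_to_comp comp1m par_fromK.
Defined.

(* Characterized by: [rotate] at A ⅋ B is [rotate] at A followed by [rotate]
   at B, modulo (A ⅋ B)^* ≅ B^* ⊗ A^* and this isomorphism. *)
Definition ldual_par (A B : C) : iso (^* B ⊗ ^* A) (^* (par_ob A B)) :=
  iso_comp (iso_cmap (ldual S) (par_iso A B)) (lrdual S (^* B ⊗ ^* A)).

End Par.

Notation "A ⅋[ S ] B" := (tob (par S) A B)
  (at level 35, right associativity, format "A  ⅋[ S ]  B") : cat_scope.

(* Main.v *)
From Corelib Require Import ssreflect ssrfun.
From Stdlib Require Import FunctionalExtensionality ProofIrrelevance.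
Require Import Defs.

(** The duality A |-> ^*A is a contravariant equivalence which reverses the
    order of tensors, ^*B ⊗ ^*A ≅ ^*(A ⅋ B), coherently with associators and
    units.  Such an equivalence (a [duality]) turns each of the five axioms of
    a right trace at the objects ^*X, ^*A, ^*B into the corresponding axiom of
    a left trace at X, A, B: a morphism of C is determined by its dual, so each
    axiom is checked after applying the duality, and the coherence diagrams
    identify the two sides ([transport]).

    That transport is bijective is a formal consequence.  The quasi-inverse of
    a duality, here A |-> A^*, is a duality again, between the reversed
    monoidal categories ([inverse_duality]), and reversal exchanges left and
    right traces; so it carries left traces back to right traces.  A right trace
    taken forth and back is its conjugate by the isomorphisms A ≅ ^*(A^* ),
    and a trace does not change under such conjugation ([rtr_conj]).  Hence
    every transport has a left inverse, and is injective.  The left inverse is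
    itself a transport, hence injective, and an injective left inverse is a
    two-sided inverse ([transport_bij]).

    What remains is that [ldual_par] is coherent.  It is a composite of many
    transpositions, so its diagrams are compared after pairing with an arbitrary
    h : W ⊗ Z^* -> ⊥: by [rotate_faithful] the morphisms into ^*Z are detected
    by [rotate], and [rotate_ldual_par] says that rotating past A ⅋ B is
    rotating past A and then past B.  Both sides of each diagram then become
    iterated rotations of h, which differ by a pentagon or triangle of ⊗. *)

Set Implicit Arguments.
Unset Strict Implicit.
Unset Printing Implicit Defensive.
Local Open Scope cat_scope.

(** * Calculating with isomorphisms *)

Section Isos.

Context (C : category).

Lemma comp_square (A B B' D Z : C) (g : hom B D) (f : hom A B)
    (g' : hom B' D) (f' : hom A B') (k : hom Z A) :
  g ∘ f = g' ∘ f' -> g ∘ (f ∘ k) = g' ∘ (f' ∘ k).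
Proof. by move=> e; rewrite compA e -compA. Qed.

Lemma comp_hexagon (A B B' D D' E Z : C) (h : hom D E) (g : hom B D)
    (f : hom A B) (h' : hom D' E) (g' : hom B' D') (f' : hom A B')
    (k : hom Z A) :
  h ∘ (g ∘ f) = h' ∘ (g' ∘ f') -> h ∘ (g ∘ (f ∘ k)) = h' ∘ (g' ∘ (f' ∘ k)).
Proof. by move=> e; rewrite !(compA _ _ k) e -!compA. Qed.

Lemma fwdK_comp (A B Z : C) (i : iso A B) (k : hom Z A) :
  bwd i ∘ (fwd i ∘ k) = k.
Proof. by rewrite compA fwdK comp1m. Qed.

Lemma bwdK_comp (A B Z : C) (i : iso A B) (k : hom Z B) :
  fwd i ∘ (bwd i ∘ k) = k.
Proof. by rewrite compA bwdK comp1m. Qed.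

(** A coherence diagram of isomorphisms, inverted: this yields the version
    for [bwd] of any diagram stated for [fwd]. *)
Lemma bwd_unique (A B : C) (i j : iso A B) : fwd i = fwd j -> bwd i = bwd j.
Proof.
by move=> e; rewrite -[LHS]compm1 -(bwdK j) -e fwdK_comp.
Qed.

Lemma fwd_epi (A B D : C) (i : iso A B) (f g : hom B D) :
  f ∘ fwd i = g ∘ fwd i -> f = g.
Proof. by move=> e; rewrite -[f]compm1 -(bwdK i) compA e -compA bwdK compm1. Qed.

Lemma fwd_mono (A B D : C) (i : iso A B) (f g : hom D A) :
  fwd i ∘ f = fwd i ∘ g -> f = g.
Proof. by move=> e; rewrite -(fwdK_comp i f) e fwdK_comp. Qed.

End Isos.

(** * Reversing a monoidal category *)

Section Reverse.

Context (C : category) (M : monoidal C).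

Let rtob (A B : C) := B ⊗[M] A.
Let rtmap (A A' B B' : C) (f : hom A A') (g : hom B B') :
  hom (rtob A B) (rtob A' B') := g ⊗₁[M] f.
Let rassoc (A B D : C) : iso (rtob (rtob A B) D) (rtob A (rtob B D)) :=
  iso_inv (assoc M D B A).

Lemma rev_tmap1 A B : rtmap (idm A) (idm B) = idm (rtob A B).
Proof. exact: tmap1. Qed.

Lemma rev_tmapM A A' A'' B B' B'' (f' : hom A' A'') (f : hom A A')
    (g' : hom B' B'') (g : hom B B') :
  rtmap (f' ∘ f) (g' ∘ g) = rtmap f' g' ∘ rtmap f g.
Proof. exact: tmapM. Qed.

Lemma rev_assoc_nat A A' B B' D D'
    (f : hom A A') (g : hom B B') (h : hom D D') :
  fwd (rassoc A' B' D') ∘ rtmap (rtmap f g) h =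
  rtmap f (rtmap g h) ∘ fwd (rassoc A B D).
Proof. exact: (iso_nat (assoc_nat M h g f)). Qed.

Lemma rev_pentagon A B D E :
  rtmap (idm A) (fwd (rassoc B D E)) ∘ fwd (rassoc A (rtob B D) E)
    ∘ rtmap (fwd (rassoc A B D)) (idm E) =
  fwd (rassoc A B (rtob D E)) ∘ fwd (rassoc (rtob A B) D E).
Proof.
pose i := iso_comp (iso_tmap M (iso_id E) (assoc M D B A))
  (iso_comp (assoc M E (D ⊗[M] B) A)
    (iso_tmap M (assoc M E D B) (iso_id A))).
pose j := iso_comp (assoc M E D (B ⊗[M] A)) (assoc M (E ⊗[M] D) B A).
(* The pentagon for the reversed tensor is the inverse of the pentagon. *)
have e : fwd i = fwd j by rewrite /= compA pentagon.
exact: (bwd_unique e).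
Qed.

Lemma rev_triangle A B :
  rtmap (idm A) (fwd (runitor M B)) ∘ fwd (rassoc A (unit M) B) =
  rtmap (fwd (lunitor M A)) (idm B).
Proof.
by rewrite /rtmap -triangle -compA bwdK; exact: compm1.
Qed.

Definition rev : monoidal C :=
  Monoidal rev_tmap1 rev_tmapM rev_assoc_nat (runitor_nat M) (lunitor_nat M)
    rev_pentagon rev_triangle.

(** The axioms of a left trace are literally those of a right trace for the
    reversed tensor, so only the record has to be repackaged. *)
Definition rev_left_trace (L : left_trace M) : right_trace rev :=
  @RightTrace C rev (@ltr C M L) (@ltr_tight C M L) (@ltr_slide C M L)
    (@ltr_unit C M L) (@ltr_tensor C M L)
    (fun X A B D E g f => @ltr_superpose C M L X A B D E g f).

Definition unrev_left_trace (L : left_trace rev) : right_trace M :=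
  @RightTrace C M (@ltr C rev L) (@ltr_tight C rev L) (@ltr_slide C rev L)
    (@ltr_unit C rev L) (@ltr_tensor C rev L)
    (fun X A B D E g f => @ltr_superpose C rev L X A B D E g f).

End Reverse.

(** * Equality and invariance of traces *)

Lemma right_trace_ext (C : category) (M : monoidal C) (R R' : right_trace M) :
  (forall X A B f, R X A B f = R' X A B f) -> R = R'.
Proof.
case: R R' => [r a1 a2 a3 a4 a5] [r' b1 b2 b3 b4 b5] /= e.
have {}e : r = r'.
  by do 4![apply: functional_extensionality_dep => ?]; exact: e.
case: _ / e in b1 b2 b3 b4 b5 *.
by congr RightTrace; exact: proof_irrelevance.
Qed.

Lemma left_trace_ext (C : category) (M : monoidal C) (L L' : left_trace M) :
  (forall X A B f, L X A B f = L' X A B f) -> L = L'.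
Proof.
case: L L' => [r a1 a2 a3 a4 a5] [r' b1 b2 b3 b4 b5] /= e.
have {}e : r = r'.
  by do 4![apply: functional_extensionality_dep => ?]; exact: e.
case: _ / e in b1 b2 b3 b4 b5 *.
by congr LeftTrace; exact: proof_irrelevance.
Qed.

(** Sliding cancels the isomorphism x against its inverse: the trace over X
    depends on X only up to isomorphism. *)
Lemma rtr_conj (C : category) (M : monoidal C) (R : right_trace M)
    (X X' A A' B B' : C) (x : iso X X') (a : hom A' A) (b : hom B B')
    (h : hom (A ⊗[M] X) (B ⊗[M] X)) :
  R X' A' B' ((b ⊗₁[M] fwd x) ∘ h ∘ (a ⊗₁[M] bwd x)) = b ∘ R X A B h ∘ a.
Proof.
have -> : a ⊗₁[M] bwd x = (idm A ⊗₁[M] bwd x) ∘ (a ⊗₁[M] idm X').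
  by rewrite -tmapM comp1m compm1.
have -> : b ⊗₁[M] fwd x = (b ⊗₁[M] idm X') ∘ (idm B ⊗₁[M] fwd x).
  by rewrite -tmapM comp1m compm1.
transitivity (R X' A' B' ((b ⊗₁[M] idm X') ∘
    ((idm B ⊗₁[M] fwd x) ∘ (h ∘ (idm A ⊗₁[M] bwd x))) ∘ (a ⊗₁[M] idm X'))).
  by rewrite -!compA.
by rewrite rtr_tight rtr_slide -(compA h) -tmapM fwdK comp1m tmap1 compm1.
Qed.

(** * Dualities between monoidal categories *)

(** An order-reversing strong monoidal contravariant equivalence.  The
    quasi-inverse is part of the data, symmetrically to [dual], so that the two
    can be exchanged in [inverse_duality].  The unit diagram pairs the unitors
    that occur in the unit axioms of left traces on N and right traces on M. *)
Record duality (C : category) (M N : monoidal C) := Duality {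
  dual :> contravariant C;
  codual : contravariant C;
  codualK : forall A : C, iso A (dual (codual A));
  codualK_nat : forall (A B : C) (f : hom A B),
    fwd (codualK B) ∘ f = cmap dual (cmap codual f) ∘ fwd (codualK A);
  dualK : forall A : C, iso A (codual (dual A));
  dualK_nat : forall (A B : C) (f : hom A B),
    fwd (dualK B) ∘ f = cmap codual (cmap dual f) ∘ fwd (dualK A);
  dual_tensor : forall A B : C, iso (dual B ⊗[M] dual A) (dual (A ⊗[N] B));
  dual_one : iso (unit M) (dual (unit N));
  dual_tensor_nat : forall (A A' B B' : C) (f : hom A A') (g : hom B B'),
    cmap dual (f ⊗₁[N] g) ∘ fwd (dual_tensor A' B') =
    fwd (dual_tensor A B) ∘ (cmap dual g ⊗₁[M] cmap dual f);
  dual_tensor_assoc : forall A B D : C,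
    cmap dual (fwd (assoc N A B D)) ∘ (fwd (dual_tensor A (B ⊗[N] D))
      ∘ (fwd (dual_tensor B D) ⊗₁[M] idm (dual A))) =
    fwd (dual_tensor (A ⊗[N] B) D)
      ∘ ((idm (dual D) ⊗₁[M] fwd (dual_tensor A B))
      ∘ fwd (assoc M (dual D) (dual B) (dual A)));
  dual_tensor_unit : forall A : C,
    cmap dual (fwd (lunitor N A)) ∘ fwd (runitor M (dual A)) =
    fwd (dual_tensor (unit N) A) ∘ (idm (dual A) ⊗₁[M] fwd dual_one)
}.

Section Transport.

Context (C : category) (M N : monoidal C) (F : duality M N).

Local Notation G := (codual F).
Local Notation φ := (dual_tensor F).

(** The action of the inverse of [dual] on morphisms. *)
Definition predual (A B : C) (g : hom (F B) (F A)) : hom A B :=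
  bwd (dualK F B) ∘ cmap G g ∘ fwd (dualK F A).

Lemma codual_inj (A B : C) (f g : hom A B) : cmap G f = cmap G g -> f = g.
Proof.
move=> e; apply: (@fwd_mono _ _ _ _ (codualK F B)).
by rewrite !codualK_nat e.
Qed.

Lemma cmapK (A B : C) (f : hom A B) : predual (cmap F f) = f.
Proof. by rewrite /predual -compA -dualK_nat fwdK_comp. Qed.

Lemma predualK (A B : C) (g : hom (F B) (F A)) : cmap F (predual g) = g.
Proof.
apply: codual_inj; apply: (@fwd_epi _ _ _ _ (dualK F A)).
by rewrite -dualK_nat /predual -!compA bwdK_comp.
Qed.

Lemma dual_inj (A B : C) (f g : hom A B) : cmap F f = cmap F g -> f = g.
Proof. by move=> e; rewrite -(cmapK f) e cmapK. Qed.

Definition predual_iso (A B : C) (i : iso (F B) (F A)) : iso A B.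
Proof.
refine (@Iso C A B (predual (fwd i)) (predual (bwd i)) _ _); apply: dual_inj.
- by rewrite cmapM !predualK bwdK cmap1.
- by rewrite cmapM !predualK fwdK cmap1.
Defined.

Lemma dual_tensor_bwd_nat (A A' B B' : C) (f : hom A A') (g : hom B B') :
  bwd (φ A B) ∘ cmap F (f ⊗₁[N] g) =
  (cmap F g ⊗₁[M] cmap F f) ∘ bwd (φ A' B').
Proof. by apply: iso_nat; rewrite dual_tensor_nat. Qed.

(** The morphism whose trace defines the transported trace.  The source and
    target of f have independent factors because the sliding axiom moves a
    morphism between two different traced objects. *)
Definition dual_conj (A B A' B' : C) (f : hom (A ⊗[N] B) (A' ⊗[N] B')) :
    hom (F B' ⊗[M] F A') (F B ⊗[M] F A) :=
  bwd (φ A B) ∘ cmap F f ∘ fwd (φ A' B').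

Lemma dual_conjM (A B A' B' A'' B'' : C)
    (g : hom (A' ⊗[N] B') (A'' ⊗[N] B'')) (f : hom (A ⊗[N] B) (A' ⊗[N] B')) :
  dual_conj (g ∘ f) = dual_conj f ∘ dual_conj g.
Proof. by rewrite /dual_conj cmapM -!compA bwdK_comp. Qed.

Lemma dual_conj_tmap (A A' B B' : C) (f : hom A A') (g : hom B B') :
  dual_conj (f ⊗₁[N] g) = cmap F g ⊗₁[M] cmap F f.
Proof. by rewrite /dual_conj dual_tensor_bwd_nat -compA fwdK compm1. Qed.

(** [dual_lunitor_conj], [dual_assoc_conj] and [dual_superpose_conj] prepare the
    unit, tensor and superposition axioms: each uses one coherence diagram, once
    forwards at the source of a morphism and once inverted at its target, to
    reach a form in which the axiom of the right trace applies. *)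
Lemma dual_lunitor_conj (A B : C) (f : hom (unit N ⊗[N] A) (unit N ⊗[N] B)) :
  cmap F (fwd (lunitor N B) ∘ f ∘ bwd (lunitor N A)) =
  fwd (runitor M (F A)) ∘
    ((idm (F A) ⊗₁[M] bwd (dual_one F)) ∘ dual_conj f
       ∘ (idm (F B) ⊗₁[M] fwd (dual_one F))) ∘ bwd (runitor M (F B)).
Proof.
pose i A := iso_comp (φ (unit N) A) (iso_tmap M (iso_id (F A)) (dual_one F)).
pose j A := iso_comp (iso_cmap F (lunitor N A)) (runitor M (F A)).
have e D : fwd (j D) = fwd (i D) by exact: dual_tensor_unit.
have e' := bwd_unique (e A); have {}e := e B; rewrite /= in e e'.
rewrite /dual_conj -!compA -(comp_square _ e) bwdK compm1.
by rewrite -(comp_square _ e') bwdK_comp !cmapM compA.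
Qed.

Lemma dual_tensor_assoc_inv (A B D : C) :
  cmap F (bwd (assoc N A B D)) ∘ (fwd (φ (A ⊗[N] B) D)
    ∘ (idm (F D) ⊗₁[M] fwd (φ A B))) =
  fwd (φ A (B ⊗[N] D)) ∘ ((fwd (φ B D) ⊗₁[M] idm (F A))
    ∘ bwd (assoc M (F D) (F B) (F A))).
Proof.
apply: (@fwd_epi _ _ _ _ (assoc M (F D) (F B) (F A))).
rewrite -!compA fwdK compm1 -dual_tensor_assoc compA -cmapM bwdK cmap1.
by rewrite comp1m.
Qed.

Lemma dual_assoc_conj (X Y A B : C)
    (f : hom (Y ⊗[N] (X ⊗[N] A)) (Y ⊗[N] (X ⊗[N] B))) :
  (idm (F A) ⊗₁[M] fwd (φ Y X)) ∘
    (fwd (assoc M (F A) (F X) (F Y)) ∘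
       ((bwd (φ X A) ⊗₁[M] idm (F Y)) ∘ dual_conj f
          ∘ (fwd (φ X B) ⊗₁[M] idm (F Y)))
       ∘ bwd (assoc M (F B) (F X) (F Y))) ∘
    (idm (F B) ⊗₁[M] bwd (φ Y X)) =
  dual_conj (bwd (assoc N Y X B) ∘ f ∘ fwd (assoc N Y X A)).
Proof.
pose i A := iso_comp (iso_cmap F (iso_inv (assoc N Y X A)))
  (iso_comp (φ (Y ⊗[N] X) A) (iso_tmap M (iso_id (F A)) (φ Y X))).
pose j A := iso_comp (φ Y (X ⊗[N] A))
  (iso_comp (iso_tmap M (φ X A) (iso_id (F Y)))
     (iso_inv (assoc M (F A) (F X) (F Y)))).
have e D : fwd (i D) = fwd (j D) by exact: dual_tensor_assoc_inv.
have e' := bwd_unique (e A); have {}e := e B; rewrite /= in e e'.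
rewrite -!compA in e e'.
rewrite /dual_conj !cmapM -!compA -(comp_hexagon _ e') -(comp_hexagon _ e).
rewrite compA -tmapM bwdK comp1m tmap1 comp1m -tmapM bwdK comp1m tmap1.
by rewrite compm1.
Qed.

Lemma dual_superpose_conj (X A B D E : C) (g : hom D E)
    (f : hom (X ⊗[N] A) (X ⊗[N] B)) :
  (fwd (φ A D) ⊗₁[M] idm (F X)) ∘
    (bwd (assoc M (F D) (F A) (F X)) ∘ (cmap F g ⊗₁[M] dual_conj f)
       ∘ fwd (assoc M (F E) (F B) (F X))) ∘
    (bwd (φ B E) ⊗₁[M] idm (F X)) =
  dual_conj (fwd (assoc N X B E) ∘ (f ⊗₁[N] g) ∘ bwd (assoc N X A D)).
Proof.
pose i A D := iso_comp (iso_cmap F (assoc N X A D))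
  (iso_comp (φ X (A ⊗[N] D)) (iso_tmap M (φ A D) (iso_id (F X)))).
pose j A D := iso_comp (φ (X ⊗[N] A) D)
  (iso_comp (iso_tmap M (iso_id (F D)) (φ X A)) (assoc M (F D) (F A) (F X))).
have e A' D' : fwd (i A' D') = fwd (j A' D') by exact: dual_tensor_assoc.
have e' := bwd_unique (e A D); have {}e := e B E; rewrite /= in e e'.
rewrite -!compA in e e'.
have -> : cmap F g ⊗₁[M] dual_conj f =
    (idm (F D) ⊗₁[M] bwd (φ X A)) ∘ (bwd (φ (X ⊗[N] A) D)
      ∘ (cmap F (f ⊗₁[N] g) ∘ (fwd (φ (X ⊗[N] B) E)
      ∘ (idm (F E) ⊗₁[M] fwd (φ X B))))).
  rewrite (comp_square _ (dual_tensor_nat _ _ _)) fwdK_comp -!tmapM.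
  by rewrite comp1m compm1 compA.
rewrite /dual_conj !cmapM -!compA -(comp_hexagon _ e') -(comp_hexagon _ e).
rewrite compA -tmapM bwdK comp1m tmap1 comp1m -tmapM bwdK comp1m tmap1.
by rewrite compm1.
Qed.

(** * Transport of traces along a duality *)

Definition transport_ltr (R : right_trace M) (X A B : C)
    (f : hom (X ⊗[N] A) (X ⊗[N] B)) : hom A B :=
  predual (R (F X) (F B) (F A) (dual_conj f)).

Lemma transport_tight (R : right_trace M) (X A A' B B' : C)
    (f : hom A A') (h : hom (X ⊗[N] A') (X ⊗[N] B)) (g : hom B B') :
  transport_ltr R ((idm X ⊗₁[N] g) ∘ h ∘ (idm X ⊗₁[N] f)) =
  g ∘ transport_ltr R h ∘ f.
Proof.
apply: dual_inj; rewrite /transport_ltr 2!cmapM !predualK !dual_conjM.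
rewrite !dual_conj_tmap !cmap1.
by rewrite compA rtr_tight compA.
Qed.

Lemma transport_slide (R : right_trace M) (X X' A B : C)
    (p : hom X X') (h : hom (X' ⊗[N] A) (X ⊗[N] B)) :
  transport_ltr R ((p ⊗₁[N] idm B) ∘ h) =
  transport_ltr R (h ∘ (p ⊗₁[N] idm A)).
Proof.
rewrite /transport_ltr !dual_conjM !dual_conj_tmap !cmap1.
by rewrite rtr_slide.
Qed.

Lemma transport_unit (R : right_trace M) (A B : C)
    (f : hom (unit N ⊗[N] A) (unit N ⊗[N] B)) :
  transport_ltr R f = fwd (lunitor N B) ∘ f ∘ bwd (lunitor N A).
Proof.
apply: dual_inj; rewrite /transport_ltr predualK dual_lunitor_conj -(rtr_unit R).
have := rtr_conj R (iso_inv (dual_one F)) (idm (F B)) (idm (F A)).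
by move=> /= ->; rewrite comp1m compm1.
Qed.

Lemma transport_tensor (R : right_trace M) (X Y A B : C)
    (f : hom (Y ⊗[N] (X ⊗[N] A)) (Y ⊗[N] (X ⊗[N] B))) :
  transport_ltr R (transport_ltr R f) =
  transport_ltr R (bwd (assoc N Y X B) ∘ f ∘ fwd (assoc N Y X A)).
Proof.
apply: dual_inj; rewrite /transport_ltr !predualK -dual_assoc_conj.
rewrite rtr_conj comp1m compm1 -rtr_tensor rtr_tight.
by rewrite /dual_conj predualK.
Qed.

Lemma transport_superpose (R : right_trace M) (X A B D E : C)
    (g : hom D E) (f : hom (X ⊗[N] A) (X ⊗[N] B)) :
  transport_ltr R f ⊗₁[N] g =
  transport_ltr R
    (fwd (assoc N X B E) ∘ (f ⊗₁[N] g) ∘ bwd (assoc N X A D)).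
Proof.
apply: dual_inj; rewrite /transport_ltr predualK -dual_superpose_conj rtr_tight.
rewrite -rtr_superpose -[R _ _ _ _ in RHS]predualK -dual_tensor_nat.
by rewrite -compA bwdK compm1.
Qed.

Definition transport (R : right_trace M) : left_trace N :=
  LeftTrace (transport_tight R) (transport_slide R) (@transport_unit R)
    (@transport_tensor R) (transport_superpose R).

(** * The inverse duality *)

(** There is only one choice that makes [codualK] monoidal, as expressed by
    [codual_tensor_counit]: its coherence then follows from that of
    [dual_tensor] by naturality, once [dual] is applied to the diagrams. *)
Definition codual_tensor (A B : C) : iso (G A ⊗[N] G B) (G (B ⊗[M] A)) :=
  predual_iso (iso_comp (φ (G A) (G B))
    (iso_comp (iso_tmap M (codualK F B) (codualK F A))
      (iso_inv (codualK F (B ⊗[M] A))))).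

Definition codual_one : iso (unit N) (G (unit M)) :=
  predual_iso (iso_comp (dual_one F) (iso_inv (codualK F (unit M)))).

Lemma codual_tensor_counit (A B : C) :
  cmap F (fwd (codual_tensor A B)) ∘ fwd (codualK F (B ⊗[M] A)) =
  fwd (φ (G A) (G B)) ∘ (fwd (codualK F B) ⊗₁[M] fwd (codualK F A)).
Proof. by rewrite predualK /= -!compA fwdK compm1. Qed.

Lemma codual_one_counit :
  cmap F (fwd codual_one) ∘ fwd (codualK F (unit M)) = fwd (dual_one F).
Proof. by rewrite predualK /= -!compA fwdK compm1. Qed.

Lemma codual_tensor_nat (A A' B B' : C) (f : hom A A') (g : hom B B') :
  cmap G (g ⊗₁[M] f) ∘ fwd (codual_tensor A' B') =
  fwd (codual_tensor A B) ∘ (cmap G f ⊗₁[N] cmap G g).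
Proof.
apply: dual_inj; apply: (@fwd_epi _ _ _ _ (codualK F _)).
rewrite 2!cmapM -!compA -codualK_nat codual_tensor_counit.
rewrite (comp_square _ (codual_tensor_counit _ _)).
by rewrite (comp_square _ (dual_tensor_nat _ _ _)) -!tmapM !codualK_nat.
Qed.

Lemma codual_tensor_assoc (A B D : C) :
  cmap G (bwd (assoc M D B A)) ∘ (fwd (codual_tensor A (D ⊗[M] B))
    ∘ (idm (G A) ⊗₁[N] fwd (codual_tensor B D))) =
  fwd (codual_tensor (B ⊗[M] A) D)
    ∘ ((fwd (codual_tensor A B) ⊗₁[N] idm (G D))
    ∘ bwd (assoc N (G A) (G B) (G D))).
Proof.
apply: dual_inj; apply: (@fwd_epi _ _ _ _ (codualK F _)).
rewrite 4!cmapM -!compA -codualK_nat.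
rewrite (comp_square _ (codual_tensor_counit _ _)) codual_tensor_counit.
rewrite !(comp_square _ (dual_tensor_nat _ _ _)) !cmap1.
rewrite (compA (cmap F _ ⊗₁[M] _)) -!tmapM !codual_tensor_counit !comp1m.
have -> : fwd (codualK F D) ⊗₁[M]
      (fwd (φ (G A) (G B)) ∘ fwd (codualK F B) ⊗₁[M] fwd (codualK F A)) =
    (idm _ ⊗₁[M] fwd (φ (G A) (G B))) ∘
    (fwd (codualK F D) ⊗₁[M] (fwd (codualK F B) ⊗₁[M] fwd (codualK F A))).
  by rewrite -tmapM comp1m.
rewrite (comp_hexagon _ (dual_tensor_assoc_inv _ _ _)).
rewrite (iso_nat (assoc_nat _ _ _ _)); congr (_ ∘ _).
by rewrite compA -tmapM comp1m.
Qed.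

Lemma codual_tensor_unit (A : C) :
  cmap G (fwd (runitor M A)) ∘ fwd (lunitor N (G A)) =
  fwd (codual_tensor (unit M) A) ∘ (fwd codual_one ⊗₁[N] idm (G A)).
Proof.
apply: dual_inj; apply: (@fwd_epi _ _ _ _ (codualK F _)).
rewrite 2!cmapM -!compA -codualK_nat codual_tensor_counit.
rewrite (comp_square _ (dual_tensor_nat _ _ _)) -tmapM codual_one_counit.
rewrite cmap1 comp1m.
have -> : fwd (codualK F A) ⊗₁[M] fwd (dual_one F) =
    (idm (F (G A)) ⊗₁[M] fwd (dual_one F)) ∘
    (fwd (codualK F A) ⊗₁[M] idm (unit M)).
  by rewrite -tmapM comp1m compm1.
by rewrite -(comp_square _ (dual_tensor_unit _ _)) runitor_nat.
Qed.

End Transport.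

(** In terms of N and M the isomorphism [codual_tensor] goes from
    G A ⊗ G B to G (B ⊗ A), which is the shape required of a duality from
    [rev N] to [rev M]. *)
Definition inverse_duality (C : category) (M N : monoidal C)
    (F : duality M N) : duality (rev N) (rev M) :=
  @Duality C (rev N) (rev M) (codual F) (dual F)
    (dualK F) (dualK_nat F) (codualK F) (codualK_nat F)
    (codual_tensor F) (codual_one F)
    (fun A A' B B' f g => codual_tensor_nat F f g)
    (codual_tensor_assoc F) (codual_tensor_unit F).

(** * Transport is a bijection *)

Section Bijection.

Context (C : category) (M N : monoidal C) (F : duality M N).

Definition untransport (L : left_trace N) : right_trace M :=
  unrev_left_trace (transport (inverse_duality F) (rev_left_trace L)).

(** The coherence isomorphisms of a duality and of its inverse cancel, up to
    the comparison of A with its double dual. *)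
Lemma dual_conj_codual (X A B : C) (h : hom (A ⊗[M] X) (B ⊗[M] X)) :
  dual_conj F (dual_conj (inverse_duality F)
    (h : hom (X ⊗[rev M] A) (X ⊗[rev M] B))) =
  (fwd (codualK F B) ⊗₁[M] fwd (codualK F X)) ∘ h
    ∘ (bwd (codualK F A) ⊗₁[M] bwd (codualK F X)).
Proof.
rewrite /dual_conj /= 2!cmapM !predualK /=.
rewrite -!compA !fwdK_comp.
by rewrite fwdK compm1 -(comp_square _ (codualK_nat F h)) fwdK_comp.
Qed.

Lemma transportK : cancel (@transport C M N F) untransport.
Proof.
move=> R; apply: right_trace_ext => X A B h.
rewrite /= /transport_ltr /=.
rewrite {1}/predual /= predualK.
rewrite dual_conj_codual rtr_conj.
by rewrite -!compA fwdK_comp fwdK compm1.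
Qed.

End Bijection.

(** [untransport F] is built from the transport along the inverse duality,
    which is injective because [transportK] applies to that duality as well. *)
Lemma transport_bij (C : category) (M N : monoidal C) (F : duality M N) :
  bijective (@transport C M N F).
Proof.
exists (untransport F); first exact: transportK.
move=> L.
have unrev_inj : injective (@unrev_left_trace C M).
  move=> L1 L2 e; apply: left_trace_ext => X A B f.
  exact: (congr1 (fun R : right_trace M => R X A B f) e).
have rev_inj : injective (@rev_left_trace C N).
  move=> L1 L2 e; apply: left_trace_ext => X A B f.
  exact: (congr1 (fun R : right_trace (rev N) => R X A B f) e).
apply: rev_inj; apply: (can_inj (transportK (inverse_duality F))).
apply: unrev_inj; exact: (transportK F).
Qed.

(** * Unitors of a tensor product *)

Section UnitorOfTensor.

Context (C : category) (M : monoidal C).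

Lemma tmap_unitl_inj (A B : C) (f g : hom A B) :
  idm (unit M) ⊗₁[M] f = idm (unit M) ⊗₁[M] g -> f = g.
Proof.
move=> e; apply: (@fwd_epi _ _ _ _ (lunitor M A)).
by rewrite -!lunitor_nat e.
Qed.

(** Kelly's argument: after tensoring with the unit on the left, the pentagon
    reduces the claim to two instances of the triangle. *)
Lemma lunitor_tensor (A B : C) :
  fwd (lunitor M (A ⊗[M] B)) ∘ fwd (assoc M (unit M) A B) =
  fwd (lunitor M A) ⊗₁[M] idm B.
Proof.
apply: tmap_unitl_inj.
pose i := iso_comp (assoc M (unit M) (unit M ⊗[M] A) B)
  (iso_tmap M (assoc M (unit M) (unit M) A) (iso_id B)).
apply: (@fwd_epi _ _ _ _ i) => /=.
rewrite -{1}[idm (unit M)]comp1m tmapM -compA.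
rewrite (compA (_ ⊗₁[M] fwd (assoc _ _ _ _))).
rewrite pentagon !compA triangle -assoc_nat -compA -tmapM triangle comp1m.
by rewrite assoc_nat tmap1.
Qed.

End UnitorOfTensor.

Lemma runitor_tensor (C : category) (M : monoidal C) (A B : C) :
  (idm A ⊗₁[M] fwd (runitor M B)) ∘ fwd (assoc M A B (unit M)) =
  fwd (runitor M (A ⊗[M] B)).
Proof.
have /= <- := lunitor_tensor (rev M) B A.
by rewrite -compA fwdK compm1.
Qed.

(** * Rotation and the dual of a par *)

Section LeftDual.

Context (C : category) (S : star_autonomous C).

Local Notation "A ⊗ B" := (tob S A B) (at level 35, right associativity).
Local Notation "f ⊗₁ g" := (tmap S f g) (at level 35, right associativity).
Local Notation "A ^*" := (rdual S A) (at level 2, format "A ^*").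
Local Notation "^* A" := (ldual S A) (at level 2, format "^* A").
Local Notation φ := (ldual_par S).
Local Notation "r⟨ A , B ⟩" := (fwd (rldual S (B^* ⊗ A^* ))).

Lemma rldual_lrdual (A : C) :
  cmap (ldual S) (fwd (rldual S A)) ∘ fwd (lrdual S (^* A)) = idm (^* A).
Proof.
rewrite lrdualE -[LHS]compm1 -lcurry_nat -runcurry_comp comp1m rldualE.
by rewrite rcurryK luncurryK.
Qed.

Lemma cmap_rldual (A : C) :
  cmap (ldual S) (fwd (rldual S A)) = bwd (lrdual S (^* A)).
Proof.
apply: (@fwd_epi _ _ _ _ (lrdual S (^* A))).
by rewrite rldual_lrdual fwdK.
Qed.

Lemma rotate_dual (W A A' : C) (h : hom (W ⊗ A^* ) (bot S)) (f : hom A A') :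
  rotate (h ∘ (idm W ⊗₁ cmap (rdual S) f)) =
  rotate h ∘ (cmap (ldual S) f ⊗₁ idm W).
Proof.
rewrite /rotate -runcurry_nat lcurry_nat !compm1 !compA -rldual_nat.
by rewrite -!(compA (fwd _)) (iso_nat (lrdual_nat S f)).
Qed.

Lemma rotate_nat (V W A A' : C) (h : hom (W ⊗ A^* ) (bot S)) (v : hom V W)
    (f : hom A A') :
  rotate (h ∘ (v ⊗₁ cmap (rdual S) f)) =
  rotate h ∘ (cmap (ldual S) f ⊗₁ v).
Proof.
rewrite -[v in LHS]comp1m -[cmap _ f in LHS]compm1 tmapM compA rotate_comp.
by rewrite rotate_dual -compA -tmapM comp1m compm1.
Qed.

(** Yoneda: it suffices to pair with W = Z and with the h whose rotation is the
    evaluation ^*Z ⊗ Z -> ⊥. *)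
Lemma rotate_faithful (Y Z : C) (u v : hom Y (^* Z)) :
  (forall W (h : hom (W ⊗ Z^* ) (bot S)),
     rotate h ∘ (u ⊗₁ idm W) = rotate h ∘ (v ⊗₁ idm W)) -> u = v.
Proof.
move=> /(_ Z (unrotate (luncurry (idm (^* Z))))).
rewrite !unrotateK -!luncurry_comp !comp1m => e.
by rewrite -(luncurryK u) e luncurryK.
Qed.

(** This determines [ldual_par].  It holds because h amounts to a
    morphism z : W -> A ⅋ B, and the right-hand side is the transpose of
    [par_to z], by the definition of [par_to]. *)
Lemma rotate_ldual_par (A B W : C) (h : hom (W ⊗ (par_ob S A B)^* ) (bot S)) :
  rotate h ∘ (fwd (φ A B) ⊗₁ idm W) =
  rotate (rotate (h ∘ (idm W ⊗₁ r⟨A, B⟩) ∘ fwd (assoc S W (B^* ) (A^* )))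
            ∘ fwd (assoc S (^* A) W (B^* )))
    ∘ fwd (assoc S (^* B) (^* A) W).
Proof.
(* The generalized element of A ⅋ B that corresponds to h. *)
pose z := bwd (lrdual S (par_ob S A B)) ∘ lcurry h.
have -> : h ∘ (idm W ⊗₁ r⟨A, B⟩) = luncurry z.
  by rewrite -[LHS]lcurryK lcurry_nat compm1 cmap_rldual.
rewrite -[RHS]rcurryK -/(par_to z) -[z in RHS]comp1m par_to_comp.
rewrite /rotate -compA -/z -runcurry_nat compm1; congr runcurry.
rewrite compA; congr (_ ∘ _).
rewrite /ldual_par /= cmapM -compA -rldual_nat.
by rewrite compA lrdual_rldual comp1m.
Qed.

(** * Coherence of the dual of a par *)

Lemma ldual_par_nat (A A' B B' : C) (f : hom A A') (g : hom B B') :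
  cmap (ldual S) (par_map S f g) ∘ fwd (φ A' B') =
  fwd (φ A B) ∘ (cmap (ldual S) g ⊗₁ cmap (ldual S) f).
Proof.
apply: rotate_faithful => W h.
rewrite (tmap_compl S W (cmap _ _)) (tmap_compl S W _ (_ ⊗₁ _)) !compA.
rewrite -rotate_dual !rotate_ldual_par.
rewrite /par_map -(compA h) -tmap_compr -rldual_nat tmap_compr compA.
rewrite -(compA _ (fwd _) (_ ⊗₁ _)) assoc_nat compA -rotate_nat.
rewrite -(compA _ (fwd _) (_ ⊗₁ _)) assoc_nat compA -rotate_nat.
by rewrite -!(compA _ (fwd _) (_ ⊗₁ _)) assoc_nat !compA.
Qed.

(** Rotation past A, then B, then D, with one fixed choice of bracketings in
    between.  Both sides of the associativity diagram for [ldual_par] are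
    brought to this form by the pentagon; what is left to compare is the
    argument k. *)
Definition rotate3 (A B D W : C)
    (k : hom (W ⊗ ((D^* ⊗ B^* ) ⊗ A^* )) (bot S)) :
    hom (((^* D ⊗ ^* B) ⊗ ^* A) ⊗ W) (bot S) :=
  rotate (rotate (rotate
      (k ∘ (fwd (assoc S W (D^* ⊗ B^* ) (A^* ))
        ∘ (fwd (assoc S W (D^* ) (B^* )) ⊗₁ idm (A^* ))))
    ∘ fwd (assoc S (^* A) (W ⊗ D^* ) (B^* )))
    ∘ ((idm (^* B) ⊗₁ fwd (assoc S (^* A) W (D^* )))
      ∘ fwd (assoc S (^* B) (^* A ⊗ W) (D^* ))))
    ∘ (fwd (assoc S (^* D) (^* B) (^* A ⊗ W))
      ∘ fwd (assoc S (^* D ⊗ ^* B) (^* A) W)).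

Lemma assoc_natl (A B D Z : C) (f : hom A Z) :
  fwd (assoc S Z B D) ∘ ((f ⊗₁ idm B) ⊗₁ idm D) =
  (f ⊗₁ idm (B ⊗ D)) ∘ fwd (assoc S A B D).
Proof. by rewrite assoc_nat tmap1. Qed.

Lemma assoc_natr (A B D Z : C) (f : hom D Z) :
  fwd (assoc S A B Z) ∘ (idm (A ⊗ B) ⊗₁ f) =
  (idm A ⊗₁ (idm B ⊗₁ f)) ∘ fwd (assoc S A B D).
Proof. by rewrite -assoc_nat tmap1. Qed.

Lemma rotate_ldual_par_r (A B D W : C)
    (k : hom (W ⊗ (par_ob S A (par_ob S B D))^* ) (bot S)) :
  rotate k ∘ ((fwd (φ A (par_ob S B D)) ∘ (fwd (φ B D) ⊗₁ idm (^* A)))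
                ⊗₁ idm W) =
  rotate3
    (k ∘ (idm W ⊗₁ (r⟨A, par_ob S B D⟩ ∘ (r⟨B, D⟩ ⊗₁ idm (A^* ))))).
Proof.
rewrite (tmap_compl S W (fwd _) (_ ⊗₁ _)) compA rotate_ldual_par.
rewrite -compA assoc_natl compA rotate_ldual_par.
rewrite -(compA _ (fwd _) (_ ⊗₁ fwd _)) assoc_natr compA -rotate_comp.
rewrite -2!(compA _ (fwd _) (fwd _)).
rewrite -(pentagon S (^* A) W (D^* ) (B^* )).
rewrite -(compA (_ ⊗₁ _) (fwd _)) (compA _ (_ ⊗₁ fwd _) (fwd _ ∘ _)).
rewrite -rotate_comp.
rewrite (compA _ (fwd _) (_ ⊗₁ _)) rotate_comp.
rewrite -(compA _ (fwd _) ((_ ⊗₁ _) ⊗₁ _)) assoc_nat.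
rewrite (compA _ (_ ⊗₁ (_ ⊗₁ _))) -(compA k) -tmap_compr.
by rewrite -(compA _ (fwd _) (_ ⊗₁ _)) -(compA _ (_ ⊗₁ _) (fwd _)).
Qed.

Lemma rotate_ldual_par_l (A B D W : C)
    (h : hom (W ⊗ (par_ob S (par_ob S A B) D)^* ) (bot S)) :
  rotate h ∘ ((fwd (φ (par_ob S A B) D) ∘ ((idm (^* D) ⊗₁ fwd (φ A B))
                 ∘ fwd (assoc S (^* D) (^* B) (^* A)))) ⊗₁ idm W) =
  rotate3
    (h ∘ (idm W ⊗₁ (r⟨par_ob S A B, D⟩ ∘ ((idm (D^* ) ⊗₁ r⟨A, B⟩)
            ∘ fwd (assoc S (D^* ) (B^* ) (A^* )))))).
Proof.
rewrite (tmap_compl S W (fwd (φ _ _)) (_ ∘ _)) compA rotate_ldual_par.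
rewrite (tmap_compl S W (_ ⊗₁ _) (fwd _)).
rewrite (compA _ (_ ⊗₁ _)) -(compA _ (fwd _) (_ ⊗₁ _)) assoc_nat compA.
rewrite -rotate_comp -(compA _ (fwd _) ((_ ⊗₁ _) ⊗₁ _)) assoc_natl.
rewrite (compA _ (fwd (φ _ _) ⊗₁ _)) rotate_ldual_par.
rewrite -(compA _ (fwd _) (_ ⊗₁ r⟨A, B⟩)) assoc_natr.
rewrite (compA _ (_ ⊗₁ (_ ⊗₁ _))).
rewrite -2!(compA _ (fwd _) (fwd _)).
rewrite -(pentagon S (^* B)).
rewrite (compA _ (_ ∘ _) (_ ⊗₁ idm (D^* ))) rotate_comp.
rewrite -!(compA (rotate _) (_ ⊗₁ _)) -!(compA (rotate _)) pentagon.
rewrite -(pentagon S W) -(compA h) -tmap_compr -(compA (_ ⊗₁ _) (fwd _)).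
rewrite (compA _ (_ ⊗₁ fwd _) (fwd _ ∘ _)) -(compA h) -tmap_compr.
by rewrite -(compA r⟨_, _⟩).
Qed.

Lemma ldual_par_assoc (A B D : C) :
  cmap (ldual S) (fwd (par_assoc S A B D)) ∘ (fwd (φ A (par_ob S B D))
    ∘ (fwd (φ B D) ⊗₁ idm (^* A))) =
  fwd (φ (par_ob S A B) D) ∘ ((idm (^* D) ⊗₁ fwd (φ A B))
    ∘ fwd (assoc S (^* D) (^* B) (^* A))).
Proof.
apply: rotate_faithful => W h.
rewrite rotate_ldual_par_l (tmap_compl S W (cmap _ _)) compA -rotate_dual.
rewrite rotate_ldual_par_r -compA -tmap_compr; congr (rotate3 (h ∘ (_ ⊗₁ _))).
rewrite /par_assoc /= (compA (cmap _ _)) -rldual_nat -!compA; congr (_ ∘ _).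
by rewrite -tmap_compl fwdK tmap1 compm1.
Qed.

Lemma rcurry_luncurry (U V : C) (u : hom U (^* V)) :
  rcurry (luncurry u) = cmap (rdual S) u ∘ fwd (rldual S V).
Proof.
rewrite rldualE -[RHS]compm1 -rcurry_nat; congr rcurry.
by rewrite -luncurry_comp comp1m.
Qed.

Definition rdual_unit : iso (bot S) ((unit S)^* ).
Proof.
refine (@Iso C _ _ (rcurry (fwd (lunitor S (bot S))))
  (runcurry (idm ((unit S)^* )) ∘ bwd (lunitor S _)) _ _).
- rewrite -compA (iso_nat (lunitor_nat _ _)) compA -runcurry_comp comp1m.
  by rewrite rcurryK bwdK.
- by rewrite -rcurry_comp lunitor_nat -compA fwdK compm1 runcurryK.
Defined.

(** Mirror image of [rdual_bot]: by [ldual_botE] it is the transpose of the left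
    unitor at ⊥. *)
Definition ldual_bot : iso (unit S) (^* (bot S)) :=
  iso_comp (iso_cmap (ldual S) rdual_unit) (lrdual S (unit S)).

Lemma ldual_botE :
  fwd ldual_bot = lcurry (fwd (lunitor S (bot S))).
Proof.
rewrite /= lrdualE -[LHS]compm1 -lcurry_nat; congr lcurry.
by rewrite -runcurry_comp comp1m rcurryK.
Qed.

Lemma rdual_botE : fwd (rdual_bot S) = rcurry (fwd (runitor S (bot S))).
Proof. by rewrite /= -rcurry_luncurry lcurryK. Qed.

(** Rotation past ⊥ is trivial once ^*⊥ and ⊥^* are replaced by the unit: both
    sides are z ∘ λ for the morphism z : V -> ⊥ that corresponds to k. *)
Lemma rotate_bot (V : C) (k : hom (V ⊗ (bot S)^* ) (bot S)) :
  rotate k ∘ (fwd ldual_bot ⊗₁ idm V) =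
  k ∘ (idm V ⊗₁ fwd (rdual_bot S)) ∘ bwd (runitor S V) ∘ fwd (lunitor S V).
Proof.
pose z := bwd (lrdual S (bot S)) ∘ lcurry k.
have -> : rotate k ∘ (fwd ldual_bot ⊗₁ idm V) = z ∘ fwd (lunitor S V).
  rewrite /rotate -compA -/z -runcurry_nat compm1 compA -rcurry_luncurry.
  by rewrite runcurry_comp rcurryK ldual_botE lcurryK lunitor_nat.
congr (_ ∘ _).
have -> : k = runcurry (idm _) ∘ (z ⊗₁ idm _).
  rewrite -(lcurryK k) -(bwdK_comp (lrdual S _) (lcurry k)) -/z.
  by rewrite luncurry_comp lrdualE lcurryK.
rewrite -(compA _ (_ ⊗₁ _) (_ ⊗₁ _)) tmap_swap compA -runcurry_comp comp1m.
rewrite rdual_botE rcurryK runitor_nat -compA bwdK.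
by rewrite compm1.
Qed.

Lemma ldual_par_unit (A : C) :
  cmap (ldual S) (fwd (par_lunitor S A)) ∘ fwd (runitor S (^* A)) =
  fwd (φ (bot S) A) ∘ (idm (^* A) ⊗₁ fwd ldual_bot).
Proof.
apply: rotate_faithful => W h.
rewrite (tmap_compl S W (cmap _ _)) (tmap_compl S W (fwd (φ _ _))) !compA.
rewrite -rotate_dual rotate_ldual_par.
rewrite -(compA _ (fwd _) (_ ⊗₁ _)) assoc_nat compA -rotate_comp.
rewrite -(compA _ (fwd _) (_ ⊗₁ _)) assoc_natl compA rotate_bot.
rewrite -(compA _ (fwd (lunitor S _))) lunitor_tensor rotate_comp.
rewrite -(compA (rotate _)) triangle; congr (rotate _ ∘ _).
have -> : cmap (rdual S) (fwd (par_lunitor S A)) =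
    r⟨bot S, A⟩ ∘ ((idm (A^* ) ⊗₁ fwd (rdual_bot S)) ∘ bwd (runitor S (A^* ))).
  rewrite (cmapM (rdual S) (bwd _) (cmap (ldual S) (fwd (dual_lunitor S A)))).
  by rewrite cmap_ldualK cmap_lrdual_bwd -compA fwdK compm1.
move: (fwd (rdual_bot S)) => u.
apply: (@fwd_epi _ _ _ _ (runitor S (W ⊗ A^* ))).
rewrite -(compA _ (bwd _) (fwd _)) fwdK compm1 -runitor_tensor.
rewrite -(compA _ (fwd _)) assoc_natr !tmap_compr -!compA.
congr (_ ∘ (_ ∘ (_ ∘ _))).
by rewrite compA -tmap_compr fwdK tmap1 comp1m.
Qed.

Definition ldual_duality : duality S (par S) :=
  @Duality C S (par S) (ldual S) (rdual S)
    (lrdual S) (fun A B f => lrdual_nat S f)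
    (rldual S) (fun A B f => rldual_nat S f)
    (ldual_par S) ldual_bot
    ldual_par_nat ldual_par_assoc ldual_par_unit.

End LeftDual.

(** * The equivalence of traces *)

Theorem theorem5 (C : category) (S : star_autonomous C)
    (hC : cauchy_complete C) :
  exists T : right_trace (tensor S) -> left_trace (par S),
    bijective T /\
    forall (R : right_trace (tensor S)) (X A B : C)
           (f : hom (X ⅋[S] A) (X ⅋[S] B)),
      unique
        (fun m : hom A B =>
           cmap (ldual S) m =
           R (ldual S X) (ldual S B) (ldual S A)
             (bwd (ldual_par S X A) ∘ cmap (ldual S) f
                ∘ fwd (ldual_par S X B)))
        (T R X A B f).
Proof.
exists (@transport C S (par S) (ldual_duality S)).
split; first exact: transport_bij.
move=> R X A B f.
have e := predualK (F := ldual_duality S)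
  (R _ _ _ (dual_conj (ldual_duality S) f)).
split; first exact: e.
move=> m em; apply: (@dual_inj _ _ _ (ldual_duality S)).
by rewrite /= em; exact: e.
Qed.
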